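(* Let $n\ge 1$. (1) If the additive group $\mathbb{R}^n$ has a subgroup $G$ with $G\in\mathcal{N}\setminus\mathcal{M}$, then there is no translation invariant Borel hull operation on $\mathcal{N}$ with respect to $\mathcal{N}$. (2) If $\mathbb{R}^n$ has a subgroup $H$ with $H\in\mathcal{M}\setminus\mathcal{N}$, then there is no translation invariant Borel hull operation on $\mathcal{M}$ with respect to $\mathcal{M}$.
   Context: $\mathcal{N}$ is the $\sigma$-ideal of Lebesgue null subsets of $\mathbb{R}^n$, and $\mathcal{M}$ is the $\sigma$-ideal of meager subsets of $\mathbb{R}^n$. For $A\subseteq\mathbb{R}^n$ and $x\in\mathbb{R}^n$ put $A+x=\{a+x:a\in A\}$. For a $\sigma$-ideal $\mathcal{I}$ with a Borel base, i.e. every set in $\mathcal{I}$ is contained in a Borel set in $\mathcal{I}$, and a family $\mathcal{F}$ of sets, a Borel hull operation on $\mathcal{F}$ with respect to $\mathcal{I}$ is a map $\psi$ from $\mathcal{F}$ to the Borel sets such that $A\subseteq\psi(A)$ and $\psi(A)\setminus A\in\mathcal{I}$ for all $A\in\mathcal{F}$. When $\mathcal{I}$ and $\mathcal{F}$ are translation invariant families of subsets of $\mathbb{R}^n$, such a $\psi$ is translation invariant if $\psi(A+x)=\psi(A)+x$ for all $A\in\mathcal{F}$ and $x\in\mathbb{R}^n$. *)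

(* Defs.v *)
From Stdlib Require Vectors.Fin.
From Stdlib Require Import Reals.
Open Scope R_scope.

Definition Rn (n : nat) : Type := Fin.t n -> R.
Definition set (n : nat) : Type := Rn n -> Prop.

Definition vadd {n} (x y : Rn n) : Rn n := fun i => x i + y i.
Definition vopp {n} (x : Rn n) : Rn n := fun i => - x i.
Definition vzero {n} : Rn n := fun _ => 0.

Definition translate {n} (A : set n) (x : Rn n) : set n :=
  fun z => exists a, A a /\ z = vadd a x.

Definition subset {n} (A B : set n) : Prop := forall x, A x -> B x.
Definition setD {n} (A B : set n) : set n := fun x => A x /\ ~ B x.

Definition ball {n} (x : Rn n) (eps : R) : set n :=
  fun y => forall i, Rabs (y i - x i) < eps.
Definition is_open {n} (U : set n) : Prop :=
  forall x, U x -> exists eps, 0 < eps /\ subset (ball x eps) U.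
Definition closure {n} (A : set n) : set n :=
  fun x => forall eps, 0 < eps -> exists y, A y /\ ball x eps y.
Definition interior {n} (A : set n) : set n :=
  fun x => exists U, is_open U /\ U x /\ subset U A.

Inductive borel {n} : set n -> Prop :=
  | borel_open : forall U, is_open U -> borel U
  | borel_compl : forall A, borel A -> borel (fun x => ~ A x)
  | borel_cunion : forall F : nat -> set n, (forall k, borel (F k)) ->
      borel (fun x => exists k, F k x).

Definition nowhere_dense {n} (A : set n) : Prop :=
  forall x, ~ interior (closure A) x.
Definition meager {n} (A : set n) : Prop :=
  exists F : nat -> set n, (forall k, nowhere_dense (F k)) /\
    subset A (fun x => exists k, F k x).

Fixpoint vprod (n : nat) : (Fin.t n -> R) -> R :=
  match n with
  | O => fun _ => 1
  | S m => fun f => f Fin.F1 * vprod m (fun i => f (Fin.FS i))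
  end.
Definition box_vol {n} (a b : Rn n) : R := vprod n (fun i => b i - a i).
Definition box {n} (a b : Rn n) : set n :=
  fun x => forall i, a i <= x i <= b i.
Definition null {n} (A : set n) : Prop :=
  forall eps, 0 < eps -> exists a b : nat -> Rn n,
    (forall k i, a k i <= b k i) /\
    subset A (fun x => exists k, box (a k) (b k) x) /\
    (forall N, sum_f_R0 (fun k => box_vol (a k) (b k)) N <= eps).

Definition subgroup {n} (G : set n) : Prop :=
  G vzero /\ (forall x y, G x -> G y -> G (vadd x y)) /\
  (forall x, G x -> G (vopp x)).

Definition borel_hull_op {n} (F I : set n -> Prop) (psi : set n -> set n) : Prop :=
  forall A, F A -> subset A (psi A) /\ borel (psi A) /\ I (setD (psi A) A).

Definition translation_invariant {n} (F : set n -> Prop) (psi : set n -> set n) : Prop :=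
  forall A x, F A -> psi (translate A x) = translate (psi A) x.

(* Main.v *)
From Stdlib Require Import Reals ZArith Lra Lia List FinFun Cantor Classical IndefiniteDescription.
From Stdlib Require Import FunctionalExtensionality PropExtensionality.
From Stdlib Require Vectors.Fin.
Require Import Defs.

(** Let [G] be a null non-meager subgroup and [B = psi G].  Since [G + g = G] for [g] in [G],
    the Borel set [B] is invariant under [G], and so is its complement.  As [B] is null, the
    complement is non-empty, so [B] and its complement each contain a coset of [G] and are
    both non-meager.  But a non-meager subgroup is dense, and a Borel set invariant under a
    dense group is meager or co-meager: a contradiction.  Exchanging measure and category
    gives the second part: a non-null subgroup is dense by a Steinhaus argument, and an
    invariant Borel set is null or co-null because a set sparse in one box is sparse in all
    translates of that box by the group. *)

(** * Sequences of reals *)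

(** No measure is ever constructed: the measure half works only with upper bounds on the total
    volume of box covers. Three obstacles follow. That a null set is not the whole space is itself a
    claim about covers, obtained by locating a point at which the weighted count of boxes stays
    below 1. No open set represents a Borel set modulo null sets as in the Baire property, so a weak
    density statement takes its place: a non-null set nearly fills some box, in the sense of outer
    measure. Finally, if the complement of [B] nearly fills a box, it does not follow for arbitrary
    sets that [B] is sparse there, since two complementary sets may both have full outer measure.
    This is where Borel sets are needed, through Caratheodory's criterion. The group itself need not
    be measurable, so density is proved for its closure, which is closed and again a group. As a
    dense group only gives approximate translates, the sparse box is used with a margin, which costs
    a factor depending on [n] alone. *)

Lemma nested_intervals (a b : nat -> R) :
  (forall k, a k <= a (S k)) -> (forall k, b (S k) <= b k) -> (forall k, a k <= b k) ->
  exists z, forall k, a k <= z <= b k.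
Proof.
  intros ha hb hab.
  assert (ha' : forall k j, a k <= a (k + j)%nat).
  { intros k j; induction j as [|j IH]; [rewrite Nat.add_0_r; lra|].
    rewrite Nat.add_succ_r; specialize (ha (k + j)%nat); lra. }
  assert (hb' : forall k j, b (k + j)%nat <= b k).
  { intros k j; induction j as [|j IH]; [rewrite Nat.add_0_r; lra|].
    rewrite Nat.add_succ_r; specialize (hb (k + j)%nat); lra. }
  assert (h : forall j k, a j <= b k).
  { intros j k. pose proof (ha' j k). pose proof (hb' k j). pose proof (hab (j + k)%nat).
    rewrite (Nat.add_comm k j) in *. lra. }
  destruct (completeness (fun x => exists k, x = a k)) as [z [hz1 hz2]].
  - exists (b 0%nat); intros x [k ->]; apply h.
  - exists (a 0%nat), 0%nat; reflexivity.
  - exists z; intros k; split.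
    + apply hz1; exists k; reflexivity.
    + apply hz2; intros x [j ->]; apply h.
Qed.

Lemma dependent_choice_on {X : Type} (P : nat -> X -> Prop) (Q : nat -> X -> X -> Prop) (x0 : X) :
  P 0%nat x0 -> (forall k x, P k x -> exists y, P (S k) y /\ Q k x y) ->
  exists f : nat -> X, f 0%nat = x0 /\ forall k, P k (f k) /\ Q k (f k) (f (S k)).
Proof.
  intros h0 hS.
  (* Guarding the conclusion by [P] makes the relation total on all pairs, so that plain choice
     applies. *)
  destruct (functional_choice (fun (p : nat * X) y =>
    P (fst p) (snd p) -> P (S (fst p)) y /\ Q (fst p) (snd p) y)) as [g hg].
  { intros [k x]; destruct (classic (P k x)) as [h|h].
    - destruct (hS k x h) as [y hy]; exists y; intros _; exact hy.
    - exists x; intros h'; contradiction. }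
  pose (f := fix f k := match k with O => x0 | S j => g (j, f j) end).
  assert (hf : forall k, P k (f k)).
  { intros k; induction k as [|k IH]; [exact h0|]. apply (hg (k, f k)), IH. }
  exists f; split; [reflexivity|]; intros k; split; [apply hf|].
  apply (hg (k, f k)), hf.
Qed.

Lemma sum_mono (u : nat -> R) (M N : nat) :
  (forall k, 0 <= u k) -> (M <= N)%nat -> sum_f_R0 u M <= sum_f_R0 u N.
Proof.
  intros hu hMN; induction hMN as [|N hMN IH]; [lra|].
  rewrite tech5; specialize (hu (S N)); lra.
Qed.

Lemma sum_scale (u : nat -> R) (c : R) (N : nat) :
  sum_f_R0 (fun k => c * u k) N = c * sum_f_R0 u N.
Proof. induction N as [|N IH]; simpl; [|rewrite IH]; lra. Qed.

Lemma sum_half_pow (eps : R) (N : nat) :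
  sum_f_R0 (fun k => eps * (1 / 2) ^ S k) N = eps - eps * (1 / 2) ^ S N.
Proof. induction N as [|N IH]; [simpl; lra|]. rewrite tech5, IH; simpl; lra. Qed.

Lemma half_pow_pos (k : nat) : 0 < (1 / 2) ^ k.
Proof. apply pow_lt; lra. Qed.

Lemma sum_half_pow_le (eps : R) (N : nat) :
  0 <= eps -> sum_f_R0 (fun k => eps * (1 / 2) ^ S k) N <= eps.
Proof.
  intros h; rewrite sum_half_pow.
  pose proof (Rmult_le_pos _ _ h (Rlt_le _ _ (half_pow_pos (S N)))); lra.
Qed.

Lemma pow_scale_small (q M eps : R) :
  0 <= q < 1 -> 0 <= M -> 0 < eps -> exists k, M * q ^ k < eps.
Proof.
  intros hq hM he.
  destruct (pow_lt_1_zero q) with (y := eps / (M + 1)) as [k hk].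
  - rewrite Rabs_right; lra.
  - apply Rdiv_lt_0_compat; lra.
  - exists k; specialize (hk k (le_n k)).
    assert (h0 : 0 <= q ^ k) by (apply pow_le; lra).
    rewrite Rabs_right in hk by lra.
    apply (Rmult_lt_compat_r (M + 1)) in hk; [|lra].
    unfold Rdiv in hk; rewrite Rmult_assoc, Rinv_l in hk; lra.
Qed.

Lemma sums_sup (u : nat -> R) (s : R) :
  (forall N, sum_f_R0 u N <= s) ->
  exists l, (forall N, sum_f_R0 u N <= l) /\
    forall t, (forall N, sum_f_R0 u N <= t) -> l <= t.
Proof.
  intros h.
  destruct (completeness (fun x => exists N, x = sum_f_R0 u N)) as [l [hl1 hl2]].
  - exists s; intros x [N ->]; apply h.
  - exists (sum_f_R0 u 0), 0%nat; reflexivity.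
  - exists l; split.
    + intros N; apply hl1; exists N; reflexivity.
    + intros t ht; apply hl2; intros x [N ->]; apply ht.
Qed.

(** Partial sums at different indices [M] and [N] are compared at [max M N], so the supremum [s1] of
    the sums of [u] leaves [s - s1] for every sum of [v]. This divides the volume of a cover between
    the two sides of a cut. *)
Lemma sums_split (u v : nat -> R) (s : R) :
  (forall k, 0 <= u k) -> (forall k, 0 <= v k) ->
  (forall N, sum_f_R0 u N + sum_f_R0 v N <= s) ->
  exists s1 s2, s1 + s2 <= s /\
    (forall N, sum_f_R0 u N <= s1) /\ (forall N, sum_f_R0 v N <= s2).
Proof.
  intros hu hv h.
  destruct (sums_sup u s) as [s1 [h1 h1']].
  { intros N; specialize (h N); pose proof (cond_pos_sum v N hv); lra. }
  exists s1, (s - s1); split; [lra|]; split; [exact h1|]; intros N.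
  assert (s1 <= s - sum_f_R0 v N); [|lra].
  apply h1'; intros M.
  pose proof (sum_mono u M (max M N) hu (Nat.le_max_l _ _)).
  pose proof (sum_mono v N (max M N) hv (Nat.le_max_r _ _)).
  specialize (h (max M N)); lra.
Qed.

Definition list_sum_R {X : Type} (f : X -> R) (l : list X) : R :=
  fold_right (fun x s => f x + s) 0 l.

Lemma list_sum_R_app {X : Type} (f : X -> R) (l m : list X) :
  list_sum_R f (l ++ m) = list_sum_R f l + list_sum_R f m.
Proof. induction l as [|x l IH]; simpl; [|rewrite IH]; lra. Qed.

Lemma list_sum_R_incl {X : Type} (f : X -> R) (l m : list X) :
  (forall x, 0 <= f x) -> NoDup l -> incl l m -> list_sum_R f l <= list_sum_R f m.
Proof.
  intros hf; revert m; induction l as [|x l IH]; intros m hl hi.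
  - clear hi; simpl; induction m as [|y m IHm]; simpl; [lra|]. specialize (hf y); lra.
  - inversion_clear hl as [|? ? hx hl'].
    destruct (in_split x m (hi x (or_introl eq_refl))) as [m1 [m2 ->]].
    assert (h : list_sum_R f l <= list_sum_R f (m1 ++ m2)).
    { apply IH; [exact hl'|]. intros y hy.
      specialize (hi y (or_intror hy)). rewrite in_app_iff in *; simpl in hi.
      destruct hi as [h|[->|h]]; tauto. }
    rewrite list_sum_R_app in *; simpl; lra.
Qed.

Lemma list_sum_R_map {X Y : Type} (f : Y -> R) (g : X -> Y) (l : list X) :
  list_sum_R f (map g l) = list_sum_R (fun x => f (g x)) l.
Proof. induction l as [|x l IH]; simpl; [|rewrite IH]; reflexivity. Qed.

Lemma list_sum_R_prod {X Y : Type} (f : X * Y -> R) (l : list X) (m : list Y) :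
  list_sum_R f (list_prod l m) = list_sum_R (fun x => list_sum_R (fun y => f (x, y)) m) l.
Proof.
  induction l as [|x l IH]; simpl; [reflexivity|].
  rewrite list_sum_R_app, list_sum_R_map, IH; reflexivity.
Qed.

Lemma sum_f_R0_list (u : nat -> R) (N : nat) :
  sum_f_R0 u N = list_sum_R u (seq 0 (S N)).
Proof.
  induction N as [|N IH]; [simpl; lra|].
  rewrite tech5, IH, (seq_S (S N)), list_sum_R_app; simpl; lra.
Qed.

(** The first [N + 1] Cantor codes decode to distinct pairs with both coordinates at most [N], so
    the left side sums over part of the square on the right. This bounds the volume of a cover
    assembled from countably many covers. *)
Lemma cantor_sum_le (f : nat * nat -> R) (N : nat) :
  (forall p, 0 <= f p) ->
  sum_f_R0 (fun m => f (Cantor.of_nat m)) N <=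
  sum_f_R0 (fun k => sum_f_R0 (fun j => f (k, j)) N) N.
Proof.
  intros hf; rewrite (sum_f_R0_list (fun m => f (Cantor.of_nat m))), <- list_sum_R_map.
  replace (sum_f_R0 (fun k => sum_f_R0 (fun j => f (k, j)) N) N)
    with (list_sum_R f (list_prod (seq 0 (S N)) (seq 0 (S N)))).
  - apply list_sum_R_incl; [exact hf| |].
    + apply FinFun.Injective_map_NoDup; [|apply seq_NoDup].
      intros m m'; apply Cantor.of_nat_inj.
    + intros [k j] h; apply in_map_iff in h; destruct h as [m [hm h]].
      apply in_seq in h.
      pose proof (Cantor.to_nat_non_decreasing k j) as hk.
      rewrite <- hm, Cantor.cancel_to_of in hk.
      apply in_prod; apply in_seq; lia.
  - rewrite list_sum_R_prod, sum_f_R0_list; f_equal; extensionality k.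
    symmetry; apply sum_f_R0_list.
Qed.

(** * Vectors and subgroups *)

Lemma translate_iff {n} (A : set n) (x z : Rn n) :
  translate A x z <-> A (vadd z (vopp x)).
Proof.
  split.
  - intros [a [ha ->]].
    replace (vadd (vadd a x) (vopp x)) with a; [exact ha|].
    extensionality i; unfold vadd, vopp; ring.
  - intros h; exists (vadd z (vopp x)); split; [exact h|].
    extensionality i; unfold vadd, vopp; ring.
Qed.

Lemma set_ext {n} (A B : set n) : (forall x, A x <-> B x) -> A = B.
Proof. intros h; extensionality x; apply propositional_extensionality, h. Qed.

Lemma translate_subgroup {n} (G : set n) (g : Rn n) :
  subgroup G -> G g -> translate G g = G.
Proof.
  intros [h0 [hadd hopp]] hg; apply set_ext; intros z; rewrite translate_iff; split; intros h.
  - replace z with (vadd (vadd z (vopp g)) g); [apply hadd; assumption|].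
    extensionality i; unfold vadd, vopp; ring.
  - apply hadd; [|apply hopp]; assumption.
Qed.

Lemma ball_open {n} (x : Rn n) (r : R) : is_open (ball x r).
Proof.
  intros y hy.
  (* The slack in the strict inequalities, made uniform over the finitely many coordinates. *)
  assert (h : exists eps, 0 < eps /\ forall i, Rabs (y i - x i) + eps <= r).
  { unfold ball in hy; revert x y hy; induction n as [|n IH]; intros x y hy.
    - exists 1; split; [lra|]; intros i; inversion i.
    - destruct (IH (fun i => x (Fin.FS i)) (fun i => y (Fin.FS i))) as [e [he h]].
      { intros i; apply hy. }
      exists (Rmin e (r - Rabs (y Fin.F1 - x Fin.F1))); split.
      + apply Rmin_pos; [exact he|]. specialize (hy Fin.F1); lra.
      + intros i; apply (Fin.caseS' i); [|intros j].
        * pose proof (Rmin_r e (r - Rabs (y Fin.F1 - x Fin.F1))); lra.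
        * pose proof (Rmin_l e (r - Rabs (y Fin.F1 - x Fin.F1))).
          specialize (h j); simpl in h; lra. }
  destruct h as [eps [he h]]; exists eps; split; [exact he|].
  intros z hz i; specialize (h i); specialize (hz i).
  pose proof (Rabs_triang (z i - y i) (y i - x i)) as ht.
  replace (z i - y i + (y i - x i)) with (z i - x i) in ht by ring; lra.
Qed.

Lemma ball_center {n} (x : Rn n) (r : R) : 0 < r -> ball x r x.
Proof. intros h i; rewrite Rminus_diag, Rabs_R0; exact h. Qed.

Lemma ball_le {n} (x : Rn n) (r s : R) : r <= s -> subset (ball x r) (ball x s).
Proof. intros h y hy i; specialize (hy i); lra. Qed.

Lemma subset_closure {n} (A : set n) : subset A (closure A).
Proof. intros x hx eps he; exists x; split; [exact hx|apply ball_center, he]. Qed.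

Lemma closure_subgroup {n} (G : set n) : subgroup G -> subgroup (closure G).
Proof.
  intros [h0 [hadd hopp]]; split; [|split].
  - apply subset_closure, h0.
  - intros x y hx hy eps he.
    destruct (hx (eps / 2)) as [x' [hx' dx]]; [lra|].
    destruct (hy (eps / 2)) as [y' [hy' dy]]; [lra|].
    exists (vadd x' y'); split; [apply hadd; assumption|]; intros i.
    specialize (dx i); specialize (dy i); unfold vadd.
    pose proof (Rabs_triang (x' i - x i) (y' i - y i)) as ht.
    replace (x' i - x i + (y' i - y i)) with (x' i + y' i - (x i + y i)) in ht by ring; lra.
  - intros x hx eps he; destruct (hx eps he) as [x' [hx' dx]].
    exists (vopp x'); split; [apply hopp, hx'|]; intros i; specialize (dx i); unfold vopp.
    replace (- x' i - - x i) with (- (x' i - x i)) by ring; rewrite Rabs_Ropp; exact dx.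
Qed.

Lemma vector_bounded {n} (x : Rn n) : exists M, 0 < M /\ forall i, Rabs (x i) < M.
Proof.
  induction n as [|n IH].
  - exists 1; split; [lra|]; intros i; inversion i.
  - destruct (IH (fun i => x (Fin.FS i))) as [M [hM h]].
    exists (M + Rabs (x Fin.F1)); pose proof (Rabs_pos (x Fin.F1)); split; [lra|].
    intros i; apply (Fin.caseS' i); [lra|]; intros j; specialize (h j); simpl in h; lra.
Qed.

Lemma vector_lower_bound {n} (x : Rn n) :
  (forall i, 0 < x i) -> exists m, 0 < m /\ forall i, m <= x i.
Proof.
  induction n as [|n IH]; intros hx.
  - exists 1; split; [lra|]; intros i; inversion i.
  - destruct (IH (fun i => x (Fin.FS i))) as [m [hm h]]; [intros; apply hx|].
    exists (Rmin m (x Fin.F1)); split; [apply Rmin_pos; auto|].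
    intros i; apply (Fin.caseS' i); [apply Rmin_r|]; intros j; specialize (h j); simpl in h.
    pose proof (Rmin_l m (x Fin.F1)); lra.
Qed.

(** Every [x] is [N] times [x / N], and the latter lies in the ball once [N] is large. *)
Lemma subgroup_with_ball_full {n} (L : set n) (r : R) :
  subgroup L -> 0 < r -> subset (ball vzero r) L -> forall x, L x.
Proof.
  intros [h0 [hadd hopp]] hr hball x.
  destruct (vector_bounded x) as [M [hM hx]].
  destruct (INR_archimed r M hr) as [N hN].
  assert (hNpos : 0 < INR N).
  { apply Rnot_le_lt; intros h. pose proof (pos_INR N) as h'. assert (e : INR N = 0) by lra.
    rewrite e in hN; lra. }
  assert (hmul : forall k, L (fun i => INR k * (x i / INR N))).
  { intros k; induction k as [|k IH].
    - replace (fun i => INR 0 * (x i / INR N)) with (@vzero n); [exact h0|].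
      extensionality i; unfold vzero; simpl; ring.
    - replace (fun i => INR (S k) * (x i / INR N))
        with (vadd (fun i => INR k * (x i / INR N)) (fun i => x i / INR N)).
      + apply hadd; [exact IH|]; apply hball; intros i; unfold vzero.
        rewrite Rminus_0_r; unfold Rdiv; rewrite Rabs_mult, Rabs_inv, (Rabs_right (INR N)) by lra.
        apply (Rmult_lt_reg_r (INR N)); [exact hNpos|].
        rewrite Rmult_assoc, Rinv_l by lra; specialize (hx i); lra.
      + extensionality i; unfold vadd; rewrite S_INR; ring. }
  replace x with (fun i => INR N * (x i / INR N)); [apply hmul|].
  extensionality i; field; lra.
Qed.

Lemma dense_sequence (n : nat) :
  exists p : nat -> Rn n, forall x eps, 0 < eps -> exists k, ball (p k) eps x.
Proof.
  assert (hR : exists q : nat -> R, forall x eps, 0 < eps -> exists k, Rabs (x - q k) < eps).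
  { exists (fun k => let (m, c) := Cantor.of_nat k in let (a, b) := Cantor.of_nat m in
      (INR a - INR b) / INR (S c)).
    intros x eps he.
    destruct (archimed_cor1 eps he) as [N [hN hN0]].
    destruct N as [|c]; [lia|].
    assert (hc : 0 < INR (S c)) by (apply lt_0_INR; lia).
    (* Rounding the numerator up moves the fraction by at most [/ INR (S c)], which is below
       [eps]. *)
    set (z := up (x * INR (S c))).
    assert (hz : exists a b, IZR z = INR a - INR b).
    { exists (Z.to_nat z), (Z.to_nat (- z)); rewrite !INR_IZR_INZ, <- minus_IZR; f_equal; lia. }
    destruct hz as [a [b hz]].
    exists (Cantor.to_nat (Cantor.to_nat (a, b), c)); rewrite !Cantor.cancel_of_to, <- hz.
    destruct (archimed (x * INR (S c))) as [h1 h2]; fold z in h1, h2.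
    replace (x - IZR z / INR (S c)) with (- ((IZR z - x * INR (S c)) * / INR (S c))) by (field; lra).
    pose proof (Rinv_0_lt_compat _ hc).
    rewrite Rabs_Ropp, Rabs_mult, !Rabs_right by lra.
    apply Rle_lt_trans with (1 * / INR (S c)); [apply Rmult_le_compat_r|]; lra. }
  destruct hR as [q hq].
  induction n as [|n [p hp]].
  - exists (fun _ => vzero); intros x eps he; exists 0%nat; intros i; inversion i.
  - exists (fun k i => Fin.caseS' i (fun _ => R) (q (fst (Cantor.of_nat k)))
      (fun j => p (snd (Cantor.of_nat k)) j)).
    intros x eps he.
    destruct (hq (x Fin.F1) eps he) as [k1 h1].
    destruct (hp (fun j => x (Fin.FS j)) eps he) as [k2 h2].
    exists (Cantor.to_nat (k1, k2)); intros i; rewrite Cantor.cancel_of_to.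
    apply (Fin.caseS' i); simpl; [exact h1|exact h2].
Qed.

(** * Category *)

Lemma nowhere_dense_escape {n} (A : set n) (x : Rn n) (r : R) :
  nowhere_dense A -> 0 < r ->
  exists y eps, ball x r y /\ 0 < eps /\ forall z, ball y eps z -> ~ A z.
Proof.
  intros hA hr; apply NNPP; intros hn; apply (hA x).
  exists (ball x r); split; [apply ball_open|]; split; [apply ball_center, hr|].
  intros y hy eps he; apply NNPP; intros hn'; apply hn.
  exists y, eps; split; [exact hy|]; split; [exact he|].
  intros z hz hAz; apply hn'; exists z; split; assumption.
Qed.

(** The Baire category theorem for a ball. *)
Lemma ball_not_meager {n} (x0 : Rn n) (r0 : R) : 0 < r0 -> ~ meager (ball x0 r0).
Proof.
  intros hr0 [F [hF hcov]].
  (* The k-th closed ball avoids [F k] and the closed balls are nested. *)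
  destruct (dependent_choice_on (X := Rn n * R) (fun _ c => 0 < snd c)
    (fun k c c' => (forall i, Rabs (fst c' i - fst c i) + snd c' < snd c) /\
       forall z, (forall i, Rabs (z i - fst c' i) <= snd c') -> ~ F k z) (x0, r0))
    as [c [hc0 hc]].
  - exact hr0.
  - intros k [x r] hr; simpl in hr.
    destruct (nowhere_dense_escape (F k) x (r / 2) (hF k)) as [y [e [hy [he hz]]]]; [lra|].
    (* Halving [e] fits a closed ball into the open one that avoids [F k]; since [y] is within
       [r / 2] of [x], radius [r / 4] keeps it strictly inside the previous ball. *)
    exists (y, Rmin (e / 2) (r / 4)); simpl.
    assert (0 < Rmin (e / 2) (r / 4)) by (apply Rmin_pos; lra).
    split; [assumption|]; split.
    + intros i; specialize (hy i); pose proof (Rmin_r (e / 2) (r / 4)); lra.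
    + intros z h; apply hz; intros i; specialize (h i).
      pose proof (Rmin_l (e / 2) (r / 4)); lra.
  (* The balls are cubes, so a common point is found one coordinate at a time. *)
  - assert (hz : forall i, exists z, forall k, fst (c k) i - snd (c k) <= z <= fst (c k) i + snd (c k)).
    { intros i; apply nested_intervals; intros k; destruct (hc k) as [h1 [h2 _]];
        try specialize (h2 i); try lra;
        pose proof (Rle_abs (fst (c (S k)) i - fst (c k) i));
        pose proof (Rle_abs (- (fst (c (S k)) i - fst (c k) i)));
        rewrite Rabs_Ropp in *; lra. }
    apply functional_choice in hz; destruct hz as [z hz].
    assert (hz' : forall k i, Rabs (z i - fst (c k) i) <= snd (c k)).
    { intros k i; specialize (hz i k); apply Rabs_le; lra. }
    destruct (hcov z) as [k hk].
    + intros i; specialize (hz' 1%nat i); destruct (hc 0%nat) as [_ [h _]]; specialize (h i).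
      rewrite hc0 in h; simpl in h.
      pose proof (Rabs_triang (z i - fst (c 1%nat) i) (fst (c 1%nat) i - x0 i)) as ht.
      replace (z i - fst (c 1%nat) i + (fst (c 1%nat) i - x0 i)) with (z i - x0 i) in ht by ring.
      lra.
    + destruct (hc k) as [_ [_ h]]; exact (h z (hz' (S k)) hk).
Qed.

Lemma meager_subset {n} (A B : set n) : subset A B -> meager B -> meager A.
Proof. intros h [F [hF hB]]; exists F; split; [exact hF|]; intros x hx; apply hB, h, hx. Qed.

Lemma meager_cunion {n} (A : nat -> set n) :
  (forall k, meager (A k)) -> meager (fun x => exists k, A k x).
Proof.
  intros h; apply functional_choice in h; destruct h as [F hF].
  exists (fun m => F (fst (Cantor.of_nat m)) (snd (Cantor.of_nat m))); split.
  - intros m; apply hF.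
  - intros x [k hx]; apply hF in hx; destruct hx as [j hj].
    exists (Cantor.to_nat (k, j)); rewrite Cantor.cancel_of_to; exact hj.
Qed.

Lemma meager_union {n} (A B : set n) :
  meager A -> meager B -> meager (fun x => A x \/ B x).
Proof.
  intros hA hB.
  apply (meager_subset _ (fun x => exists k, (match k with O => A | _ => B end) x)).
  - intros x [h|h]; [exists 0%nat|exists 1%nat]; exact h.
  - apply meager_cunion; intros [|k]; assumption.
Qed.

Lemma nowhere_dense_meager {n} (A : set n) : nowhere_dense A -> meager A.
Proof. intros h; exists (fun _ => A); split; [intros _; exact h|]; intros x hx; exists 0%nat; exact hx. Qed.

Lemma ball_shift {n} (x y g : Rn n) (r : R) :
  ball (vadd x g) r (vadd y g) <-> ball x r y.
Proof.
  unfold ball, vadd; split; intros h i; specialize (h i);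
    replace (y i + g i - (x i + g i)) with (y i - x i) in * by ring; exact h.
Qed.

Lemma vadd_oppK {n} (x g : Rn n) : vadd (vadd x (vopp g)) g = x.
Proof. extensionality i; unfold vadd, vopp; ring. Qed.

Lemma vaddK {n} (x g : Rn n) : vadd (vadd x g) (vopp g) = x.
Proof. extensionality i; unfold vadd, vopp; ring. Qed.

Lemma is_open_shift {n} (U : set n) (g : Rn n) :
  is_open U -> is_open (fun z => U (vadd z g)).
Proof.
  intros hU x hx; destruct (hU _ hx) as [r [hr h]]; exists r; split; [exact hr|].
  intros y hy; apply h, ball_shift, hy.
Qed.

Lemma nowhere_dense_shift {n} (A : set n) (g : Rn n) :
  nowhere_dense A -> nowhere_dense (fun z => A (vadd z g)).
Proof.
  intros hA x [U [hU [hUx hsub]]]; apply (hA (vadd x g)).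
  exists (fun z => U (vadd z (vopp g))); split; [apply is_open_shift, hU|].
  split; [rewrite vaddK; exact hUx|].
  intros z hz eps he; destruct (hsub _ hz eps he) as [y [hy hb]].
  exists (vadd y g); split; [exact hy|].
  rewrite <- (vadd_oppK z g); apply ball_shift, hb.
Qed.

Lemma meager_shift {n} (A : set n) (g : Rn n) :
  meager A -> meager (fun z => A (vadd z g)).
Proof.
  intros [F [hF h]]; exists (fun k z => F k (vadd z g)); split.
  - intros k; apply nowhere_dense_shift, hF.
  - intros z hz; apply h, hz.
Qed.

(** * Baire property and the category zero-one law *)

Definition baire_property {n} (A : set n) : Prop :=
  exists U, is_open U /\ meager (setD A U) /\ meager (setD U A).

Lemma interior_open {n} (A : set n) : is_open (interior A).
Proof.
  intros x [U [hU [hx hs]]]; destruct (hU x hx) as [r [hr h]]; exists r; split; [exact hr|].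
  intros y hy; exists U; split; [exact hU|]; split; [apply h, hy|exact hs].
Qed.

(** An open set inside the closure of this boundary misses [U], hence lies in the interior that was
    removed. *)
Lemma closed_setD_interior_nowhere_dense {n} (U : set n) :
  is_open U -> nowhere_dense (setD (fun x => ~ U x) (interior (fun x => ~ U x))).
Proof.
  intros hU x [O [hO [hx hsub]]].
  assert (hOU : subset O (fun y => ~ U y)).
  { intros y hy hUy; destruct (hU y hUy) as [r [hr h]].
    destruct (hsub y hy r hr) as [z [[hz _] hb]]; exact (hz (h z hb)). }
  destruct (hO x hx) as [r [hr h]].
  destruct (hsub x hx r hr) as [z [[_ hz] hb]]; apply hz.
  exists O; split; [exact hO|]; split; [apply h, hb|exact hOU].
Qed.

(** For a complement, the witness is the interior of the closed set [~ U]; it loses only a nowhere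
    dense boundary. *)
Lemma borel_baire_property {n} (A : set n) : borel A -> baire_property A.
Proof.
  intros hA; induction hA as [U hU|A hA [U [hU [h1 h2]]]|F hF IH].
  - exists U; split; [exact hU|].
    (* Both differences are empty, and the empty set has empty closure. *)
    split; apply (meager_subset _ (fun _ => False)); try (intros x [h h']; contradiction);
      apply nowhere_dense_meager; intros x [O [hO [hx hs]]];
      destruct (hs x hx 1 Rlt_0_1) as [y [[] _]].
  - exists (interior (fun x => ~ U x)); split; [apply interior_open|]; split.
    + apply (meager_subset _ (fun x => setD U A x \/
        setD (fun x => ~ U x) (interior (fun x => ~ U x)) x)).
      * intros x [hx hi]; destruct (classic (U x)) as [h|h]; [left|right]; split; assumption.
      * apply meager_union; [exact h2|].
        apply nowhere_dense_meager, closed_setD_interior_nowhere_dense, hU.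
    + apply (meager_subset _ (setD A U)); [|exact h1].
      intros x [[O [_ [hx hs]]] hn]; split; [apply NNPP, hn|apply hs, hx].
  - apply functional_choice in IH; destruct IH as [U hU].
    exists (fun x => exists k, U k x); split; [|split].
    + intros x [k hx]; destruct (hU k) as [ho _]; destruct (ho x hx) as [r [hr h]].
      exists r; split; [exact hr|]; intros y hy; exists k; apply h, hy.
    + apply (meager_subset _ (fun x => exists k, setD (F k) (U k) x)).
      * intros x [[k hx] hn]; exists k; split; [exact hx|]; intros h; apply hn; exists k; exact h.
      * apply meager_cunion; intros k; apply hU.
    + apply (meager_subset _ (fun x => exists k, setD (U k) (F k) x)).
      * intros x [[k hx] hn]; exists k; split; [exact hx|]; intros h; apply hn; exists k; exact h.
      * apply meager_cunion; intros k; apply hU.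
Qed.

Lemma baire_property_nonmeager {n} (A : set n) :
  baire_property A -> ~ meager A ->
  exists x r, 0 < r /\ meager (setD (ball x r) A).
Proof.
  intros [U [hU [h1 h2]]] hA.
  destruct (classic (exists x, U x)) as [[x hx]|hn].
  - destruct (hU x hx) as [r [hr h]]; exists x, r; split; [exact hr|].
    apply (meager_subset _ (setD U A)); [|exact h2].
    intros y [hy hy']; split; [apply h, hy|exact hy'].
  - exfalso; apply hA; apply (meager_subset _ (setD A U)); [|exact h1].
    intros x hx; split; [exact hx|]; intros hUx; apply hn; exists x; exact hUx.
Qed.

(** The closure is a group with an interior point; subtracting that point from a ball around it
    gives a ball around zero. *)
Lemma subgroup_nonmeager_dense {n} (G : set n) :
  subgroup G -> ~ meager G -> forall x, closure G x.
Proof.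
  intros hG hm.
  destruct (classic (nowhere_dense G)) as [h|h].
  { exfalso; apply hm, nowhere_dense_meager, h. }
  apply not_all_ex_not in h; destruct h as [x h]; apply NNPP in h.
  destruct h as [U [hU [hx hs]]]; destruct (hU x hx) as [r [hr hb]].
  pose proof (closure_subgroup G hG) as hL.
  apply (subgroup_with_ball_full _ r hL hr).
  intros y hy; rewrite <- (vaddK y x); apply hL.
  - apply hs, hb.
    replace x with (vadd vzero x) at 1; [apply ball_shift, hy|].
    extensionality i; unfold vadd, vzero; ring.
  - apply hL, hs, hx.
Qed.

Definition invariant_under {n} (G A : set n) : Prop :=
  forall g z, G g -> A z -> A (vadd z g).

Lemma invariant_compl {n} (G A : set n) :
  subgroup G -> invariant_under G A -> invariant_under G (fun x => ~ A x).
Proof.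
  intros hG hA g z hg hz h; apply hz; rewrite <- (vaddK z g).
  apply hA; [apply hG, hg|exact h].
Qed.

(** Otherwise [B] is co-meager in a ball around [u] and its complement in one around [v]. An element
    of [G] close to [v - u] carries the first ball over the centre of the second, so a small ball
    around [v] would be meager. *)
Lemma meager_dichotomy {n} (G B : set n) :
  (forall x, closure G x) -> invariant_under G B -> borel B ->
  meager B \/ meager (fun x => ~ B x).
Proof.
  intros hG hinv hB; apply NNPP; intros hn.
  destruct (baire_property_nonmeager B) as [u [r [hr hu]]].
  { apply borel_baire_property, hB. } { tauto. }
  destruct (baire_property_nonmeager (fun x => ~ B x)) as [v [s [hs hv]]].
  { apply borel_baire_property, borel_compl, hB. } { tauto. }
  destruct (hG (vadd v (vopp u)) (r / 2)) as [g [hg hd]]; [lra|].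
  (* A point within [r / 2] of [v], moved back by [g], lands within [r] of [u], since [g] misses
     [v - u] by less than [r / 2]. *)
  assert (hm : 0 < Rmin (r / 2) s) by (apply Rmin_pos; lra).
  apply (ball_not_meager v _ hm).
  apply (meager_subset _ (fun z => setD (ball v s) (fun x => ~ B x) z \/
    setD (ball u r) B (vadd z (vopp g)))).
  - intros z hz; destruct (classic (B z)) as [h|h]; [left|right]; split.
    + revert hz; apply ball_le, Rmin_r.
    + tauto.
    + intros i; specialize (hz i); specialize (hd i); unfold vadd, vopp in *.
      pose proof (Rmin_l (r / 2) s).
      pose proof (Rabs_triang (z i - v i) (- (g i - (v i + - u i)))) as ht.
      replace (z i - v i + - (g i - (v i + - u i))) with (z i + - g i - u i) in ht by ring.
      rewrite Rabs_Ropp in ht; lra.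
    + intros h'; apply h; rewrite <- (vadd_oppK z g); apply hinv; assumption.
  - apply meager_union; [exact hv|]; apply meager_shift, hu.
Qed.

(** * Volumes *)

Lemma vprod_ge0 (n : nat) (f : Fin.t n -> R) : (forall i, 0 <= f i) -> 0 <= vprod n f.
Proof.
  induction n as [|n IH]; intros h; simpl; [lra|].
  apply Rmult_le_pos; [apply h|]; apply IH; intros i; apply h.
Qed.

Lemma vprod_le (n : nat) (f g : Fin.t n -> R) :
  (forall i, 0 <= f i <= g i) -> vprod n f <= vprod n g.
Proof.
  induction n as [|n IH]; intros h; simpl; [lra|].
  apply Rmult_le_compat; try apply h.
  - apply vprod_ge0; intros i; apply h.
  - apply IH; intros i; apply h.
Qed.

Lemma vprod_pos_inv (n : nat) (f : Fin.t n -> R) :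
  (forall i, 0 <= f i) -> 0 < vprod n f -> forall i, 0 < f i.
Proof.
  induction n as [|n IH]; intros h hp i; [inversion i|]; simpl in hp.
  pose proof (h Fin.F1) as h1.
  assert (h2 : 0 <= vprod n (fun i => f (Fin.FS i))) by (apply vprod_ge0; intros j; apply h).
  apply (Fin.caseS' i).
  - apply Rnot_le_lt; intros h'; assert (e : f Fin.F1 = 0) by lra; rewrite e in hp; lra.
  - apply (IH (fun j => f (Fin.FS j))); [intros j; apply h|].
    apply Rnot_le_lt; intros h'.
    assert (e : vprod n (fun j => f (Fin.FS j)) = 0) by lra; rewrite e in hp; lra.
Qed.

Lemma vprod_scale (n : nat) (c : R) (f : Fin.t n -> R) :
  vprod n (fun i => c * f i) = c ^ n * vprod n f.
Proof. induction n as [|n IH]; simpl; [ring|]; rewrite IH; ring. Qed.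

(** Additivity of volume when a box is cut across the [i]-th axis. *)
Lemma vprod_split (n : nat) (f g h : Fin.t n -> R) (i : Fin.t n) :
  f i = g i + h i -> (forall j, j <> i -> g j = f j /\ h j = f j) ->
  vprod n f = vprod n g + vprod n h.
Proof.
  revert f g h i; induction n as [|n IH]; intros f g h i; [inversion i|].
  apply (Fin.caseS' i).
  - intros hi hj; simpl; rewrite hi.
    assert (eg : (fun j => g (Fin.FS j)) = (fun j => f (Fin.FS j))).
    { extensionality j; apply hj; discriminate. }
    assert (eh : (fun j => h (Fin.FS j)) = (fun j => f (Fin.FS j))).
    { extensionality j; apply hj; discriminate. }
    rewrite eg, eh; ring.
  - intros i' hi hj; simpl.
    destruct (hj Fin.F1) as [eg eh]; [discriminate|]; rewrite eg, eh.
    rewrite (IH _ (fun j => g (Fin.FS j)) (fun j => h (Fin.FS j)) i' hi); [ring|].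
    intros j hne; apply hj; intros e; apply hne, Fin.FS_inj, e.
Qed.

Lemma box_vol_ge0 {n} (a b : Rn n) : (forall i, a i <= b i) -> 0 <= box_vol a b.
Proof. intros h; apply vprod_ge0; intros i; specialize (h i); lra. Qed.

(** The empty product is 1, so [1 <= n] is what makes degenerate boxes free; they serve as padding
    in covers. *)
Lemma box_vol_diag {n} (a : Rn n) : (1 <= n)%nat -> box_vol a a = 0.
Proof. destruct n as [|n]; [lia|]; intros _; unfold box_vol; simpl; ring. Qed.

(** * Boxes of small total volume leave a point uncovered *)

Definition interval_ind (a b z : R) : R :=
  if Rle_dec a z then if Rle_dec z b then 1 else 0 else 0.

Lemma interval_ind_bounds (a b z : R) : 0 <= interval_ind a b z <= 1.
Proof. unfold interval_ind; destruct (Rle_dec a z); [destruct (Rle_dec z b)|]; lra. Qed.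

(** The length of the intersection of [[a, b]] and [[c, d]]. *)
Definition overlap (a b c d : R) : R := Rmax 0 (Rmin b d - Rmax a c).

Lemma overlap_split (a b c m d : R) :
  a <= b -> c <= m <= d -> overlap a b c d = overlap a b c m + overlap a b m d.
Proof.
  intros hab hm; unfold overlap, Rmax, Rmin.
  repeat destruct (Rle_dec _ _); lra.
Qed.

(* Bisection keeps the weighted mean below [e]; the intervals are first enlarged so
   that a limit point lying in a closed interval has a neighbourhood inside it. *)
Lemma weighted_intervals_light_point (u a b : nat -> R) (e : R) :
  e < 1 -> (forall k, 0 <= u k) -> (forall k, a k <= b k) ->
  (forall N, sum_f_R0 (fun k => u k * (b k - a k)) N <= e) ->
  exists z e', e' < 1 /\
    forall N, sum_f_R0 (fun k => u k * interval_ind (a k) (b k) z) N <= e'.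
Proof.
  intros he hu hab hs.
  set (eta := (1 - e) / 2).
  assert (heta : 0 < eta) by (unfold eta; lra).
  set (e' := e + eta).
  (* Enlarging interval [k] by [w k] at both ends adds at most [eta / 2 ^ (k + 1)] to its weighted
     length, hence at most [eta] in total; [1 + u k] avoids a zero denominator. *)
  set (w := fun k => eta * (1 / 2) ^ S k / (2 * (1 + u k))).
  assert (hw : forall k, 0 < w k).
  { intros k; specialize (hu k); unfold w; apply Rdiv_lt_0_compat; [|lra].
    apply Rmult_lt_0_compat; [exact heta|apply half_pow_pos]. }
  assert (huw : forall k, u k * (2 * w k) <= eta * (1 / 2) ^ S k).
  { intros k; specialize (hu k).
    assert (ew : w k * (2 * (1 + u k)) = eta * (1 / 2) ^ S k) by (unfold w; field; lra).
    specialize (hw k); rewrite <- ew; nra. }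
  set (ov := fun k c d => overlap (a k - w k) (b k + w k) c d).
  assert (hov : forall k c d, 0 <= ov k c d) by (intros; apply Rmax_l).
  destruct (dependent_choice_on (X := R * R)
    (fun _ p => fst p < snd p /\
       forall N, sum_f_R0 (fun k => u k * ov k (fst p) (snd p)) N <= e' * (snd p - fst p))
    (fun _ p q => fst p <= fst q /\ snd q <= snd p /\ snd q - fst q = (snd p - fst p) / 2)
    (0, 1)) as [p [hp0 hp]].
  - simpl; split; [lra|]; intros N.
    apply Rle_trans with
      (sum_f_R0 (fun k => u k * (b k - a k) + eta * (1 / 2) ^ S k) N).
    + apply sum_Rle; intros k _.
      assert (ho : ov k 0 1 <= b k - a k + 2 * w k).
      { unfold ov, overlap; apply Rmax_lub; [specialize (hab k); specialize (hw k); lra|].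
        pose proof (Rmin_l (b k + w k) 1); pose proof (Rmax_l (a k - w k) 0); lra. }
      specialize (huw k); apply (Rmult_le_compat_l (u k)) in ho; [lra|apply hu].
    + rewrite sum_plus; specialize (hs N).
      pose proof (sum_half_pow_le eta N (Rlt_le _ _ heta)); unfold e'; lra.
  - intros _ [c d] [hcd hsum]; simpl in hcd, hsum.
    set (m := (c + d) / 2).
    destruct (sums_split (fun k => u k * ov k c m) (fun k => u k * ov k m d) (e' * (d - c)))
      as [s1 [s2 [h12 [h1 h2]]]].
    + intros k; apply Rmult_le_pos; auto.
    + intros k; apply Rmult_le_pos; auto.
    + intros N; rewrite <- sum_plus; apply Rle_trans with (2 := hsum N), Req_le, sum_eq.
      intros k _; unfold ov; rewrite (overlap_split _ _ c m d); [ring| |unfold m; lra].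
      specialize (hab k); specialize (hw k); lra.
    (* If the left half exceeds its share of the bound, the right half stays below its own. *)
    + destruct (Rle_dec s1 (e' * (m - c))) as [h|h].
      * exists (c, m); simpl; unfold m in *; repeat split; try lra.
        intros N; apply Rle_trans with s1; auto.
      * exists (m, d); simpl; unfold m in *; repeat split; try lra.
        intros N; apply Rle_trans with s2; [auto|].
        assert (e' * (d - c) = e' * ((c + d) / 2 - c) + e' * (d - (c + d) / 2)) by field.
        lra.
  - destruct (nested_intervals (fun j => fst (p j)) (fun j => snd (p j))) as [z hz].
    { intros j; apply (hp j). } { intros j; apply (hp j). }
    { intros j; destruct (hp j) as [[h _] _]; lra. }
    assert (hlen : forall j, snd (p j) - fst (p j) = (1 / 2) ^ j).
    { intros j; induction j as [|j IH]; [rewrite hp0; simpl; lra|].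
      destruct (hp j) as [_ [_ [_ ->]]]; rewrite IH; simpl; field. }
    exists z, e'; split; [unfold e', eta; lra|]; intros N.
    (* A partial sum involves finitely many margins. Once [[c, d]] is shorter than all of them, any
       of these intervals that contains [z] contains [[c, d]] after enlargement, so its overlap is
       the full [d - c]. *)
    assert (hmin : exists r, 0 < r /\ forall k, (k <= N)%nat -> r <= w k).
    { clear - hw; induction N as [|N [r [hr h]]].
      - exists (w 0%nat); split; [apply hw|]; intros k hk; replace k with 0%nat by lia; lra.
      - exists (Rmin r (w (S N))); split; [apply Rmin_pos; auto|]; intros k hk.
        destruct (Nat.eq_dec k (S N)) as [->|hne]; [apply Rmin_r|].
        pose proof (Rmin_l r (w (S N))); specialize (h k ltac:(lia)); lra. }
    destruct hmin as [r [hr hrw]].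
    destruct (pow_scale_small (1 / 2) 1 r) as [j hj]; [lra|lra|exact hr|].
    destruct (hp j) as [[hcd hsum] _]; specialize (hz j); specialize (hlen j).
    set (c := fst (p j)) in *; set (d := snd (p j)) in *.
    apply (Rmult_le_reg_l (d - c)); [lra|].
    rewrite <- sum_scale, (Rmult_comm (d - c) e').
    apply Rle_trans with (2 := hsum N), sum_Rle; intros k hk.
    specialize (hrw k hk); pose proof (hov k c d) as ho.
    unfold interval_ind; destruct (Rle_dec (a k) z) as [h1|h1]; [destruct (Rle_dec z (b k)) as [h2|h2]|].
    + replace (ov k c d) with (d - c); [lra|].
      unfold ov, overlap; rewrite Rmin_right, (Rmax_right (a k - w k)), Rmax_right; lra.
    + rewrite !Rmult_0_r; apply Rmult_le_pos; auto.
    + rewrite !Rmult_0_r; apply Rmult_le_pos; auto.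
Qed.

Fixpoint box_ind (n : nat) : Rn n -> Rn n -> Rn n -> R :=
  match n with
  | O => fun _ _ _ => 1
  | S m => fun a b x => interval_ind (a Fin.F1) (b Fin.F1) (x Fin.F1) *
      box_ind m (fun i => a (Fin.FS i)) (fun i => b (Fin.FS i)) (fun i => x (Fin.FS i))
  end.

Lemma box_ind_1 (n : nat) (a b x : Rn n) : box a b x -> box_ind n a b x = 1.
Proof.
  induction n as [|n IH]; intros h; simpl; [reflexivity|].
  rewrite IH by (intros i; apply h).
  destruct (h Fin.F1); unfold interval_ind.
  destruct (Rle_dec _ _); [destruct (Rle_dec _ _)|]; lra.
Qed.

(** A discrete Fubini argument. The volume in the remaining coordinates acts as a weight while the
    first coordinate [z] is chosen; the indicators at [z] then become weights for the remaining
    coordinates. Hence the general [w]. *)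
Lemma weighted_boxes_light_point (n : nat) (w : nat -> R) (a b : nat -> Rn n) (e : R) :
  e < 1 -> (forall k, 0 <= w k) -> (forall k i, a k i <= b k i) ->
  (forall N, sum_f_R0 (fun k => w k * box_vol (a k) (b k)) N <= e) ->
  exists x e', e' < 1 /\
    forall N, sum_f_R0 (fun k => w k * box_ind n (a k) (b k) x) N <= e'.
Proof.
  revert w a b e; induction n as [|n IH]; intros w a b e he hw hab hs.
  - exists vzero, e; split; [exact he|exact hs].
  - destruct (weighted_intervals_light_point
      (fun k => w k * box_vol (fun i => a k (Fin.FS i)) (fun i => b k (Fin.FS i)))
      (fun k => a k Fin.F1) (fun k => b k Fin.F1) e) as [z [e1 [he1 h1]]].
    + exact he.
    + intros k; apply Rmult_le_pos; [apply hw|]; apply box_vol_ge0; intros i; apply hab.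
    + intros k; apply hab.
    + intros N; apply Rle_trans with (2 := hs N), Req_le, sum_eq; intros k _.
      unfold box_vol; simpl; ring.
    + destruct (IH (fun k => w k * interval_ind (a k Fin.F1) (b k Fin.F1) z)
        (fun k i => a k (Fin.FS i)) (fun k i => b k (Fin.FS i)) e1) as [x [e2 [he2 h2]]].
      * exact he1.
      * intros k; apply Rmult_le_pos; [apply hw|apply interval_ind_bounds].
      * intros k i; apply hab.
      * intros N; apply Rle_trans with (2 := h1 N), Req_le, sum_eq; intros k _; ring.
      * exists (fun i => Fin.caseS' i (fun _ => R) z x), e2; split; [exact he2|].
        intros N; apply Rle_trans with (2 := h2 N), Req_le, sum_eq; intros k _; simpl.
        symmetry; apply Rmult_assoc.
Qed.

(** A cover of total volume at most 1/2 has a point where the sum of indicators stays below 1, while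
    each box containing a point contributes 1 there. *)
Lemma null_ex_compl {n} (A : set n) : null A -> exists x, ~ A x.
Proof.
  intros hA; destruct (hA (1 / 2)) as [a [b [hab [hcov hs]]]]; [lra|].
  destruct (weighted_boxes_light_point n (fun _ => 1) a b (1 / 2)) as [x [e [he h]]];
    [lra|intros; lra|exact hab| |].
  - intros N; apply Rle_trans with (2 := hs N), Req_le, sum_eq; intros k _; ring.
  - exists x; intros hx; destruct (hcov x hx) as [k hk]; specialize (h k).
    assert (hterm : forall (n : nat) (a b x : Rn n), 0 <= box_ind n a b x).
    { clear; intros n; induction n as [|n IH]; intros a b x; simpl; [lra|].
      apply Rmult_le_pos; [apply interval_ind_bounds|apply IH]. }
    assert (h1 : 1 <= sum_f_R0 (fun k => 1 * box_ind n (a k) (b k) x) k); [|lra].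
    destruct k as [|k]; simpl; rewrite (box_ind_1 _ _ _ _ hk); [lra|].
    pose proof (cond_pos_sum (fun k => 1 * box_ind n (a k) (b k) x) k) as hpos.
    assert (forall m, 0 <= 1 * box_ind n (a m) (b m) x) as hm
      by (intros m; rewrite Rmult_1_l; apply hterm).
    specialize (hpos hm); lra.
Qed.

(** * Outer measure *)

(* Stands for [outer measure of A <= s], up to attainment of the infimum. *)
Definition covered {n} (A : set n) (s : R) : Prop :=
  exists a b : nat -> Rn n,
    (forall k i, a k i <= b k i) /\
    subset A (fun x => exists k, box (a k) (b k) x) /\
    (forall N, sum_f_R0 (fun k => box_vol (a k) (b k)) N <= s).

Lemma covered_mono {n} (A B : set n) (s t : R) :
  subset A B -> s <= t -> covered B s -> covered A t.
Proof.
  intros hAB hst [a [b [hab [hc hs]]]]; exists a, b; split; [exact hab|]; split.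
  - intros x hx; apply hc, hAB, hx.
  - intros N; specialize (hs N); lra.
Qed.

Lemma covered_ge0 {n} (A : set n) (s : R) : covered A s -> 0 <= s.
Proof.
  intros [a [b [hab [_ hs]]]]; apply Rle_trans with (2 := hs 0%nat); simpl.
  apply box_vol_ge0, hab.
Qed.

Lemma covered_cunion {n} (A : nat -> set n) (t : nat -> R) (T : R) :
  (forall k, covered (A k) (t k)) -> (forall N, sum_f_R0 t N <= T) ->
  covered (fun x => exists k, A k x) T.
Proof.
  intros hA hT.
  apply functional_choice in hA; destruct hA as [a hA].
  apply functional_choice in hA; destruct hA as [b hA].
  exists (fun m => a (fst (Cantor.of_nat m)) (snd (Cantor.of_nat m))),
    (fun m => b (fst (Cantor.of_nat m)) (snd (Cantor.of_nat m))); split; [|split].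
  - intros m i; apply hA.
  - intros x [k hx]; destruct (hA k) as [_ [hc _]]; destruct (hc x hx) as [j hj].
    exists (Cantor.to_nat (k, j)); rewrite Cantor.cancel_of_to; exact hj.
  - intros N.
    apply Rle_trans with (1 := cantor_sum_le
      (fun p => box_vol (a (fst p) (snd p)) (b (fst p) (snd p))) N
      (fun p => box_vol_ge0 _ _ (proj1 (hA (fst p)) (snd p)))).
    apply Rle_trans with (2 := hT N), sum_Rle; intros k _; exact (proj2 (proj2 (hA k)) N).
Qed.

Lemma covered_box {n} (a b : Rn n) :
  (1 <= n)%nat -> (forall i, a i <= b i) -> covered (box a b) (box_vol a b).
Proof.
  intros hn hab.
  (* A cover is an infinite sequence; its tail repeats the degenerate box at [a]. *)
  exists (fun _ => a), (fun k => match k with O => b | _ => a end); split; [|split].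
  - intros [|k] i; [apply hab|lra].
  - intros x hx; exists 0%nat; exact hx.
  - intros N; induction N as [|N IH]; [simpl; lra|].
    rewrite tech5, (box_vol_diag a hn); lra.
Qed.

Lemma covered_empty {n} (A : set n) : (1 <= n)%nat -> (forall x, ~ A x) -> covered A 0.
Proof.
  intros hn hA; rewrite <- (box_vol_diag (@vzero n) hn).
  apply (covered_mono _ (box vzero vzero) (box_vol (@vzero n) vzero)); [|lra|].
  - intros x hx; destruct (hA x hx).
  - apply covered_box; [exact hn|intros; lra].
Qed.

Lemma covered_union {n} (A B : set n) (s t : R) :
  (1 <= n)%nat -> covered A s -> covered B t -> covered (fun x => A x \/ B x) (s + t).
Proof.
  intros hn hA hB.
  apply (covered_mono _ (fun x => exists k,
    (match k with 0%nat => A | 1%nat => B | _ => fun _ => False end) x) (s + t)); [|lra|].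
  - intros x [h|h]; [exists 0%nat|exists 1%nat]; exact h.
  - apply covered_cunion with (fun k => match k with 0%nat => s | 1%nat => t | _ => 0 end).
    + intros [|[|k]]; [exact hA|exact hB|]; apply covered_empty; auto.
    + pose proof (covered_ge0 _ _ hB).
      assert (h : forall N, sum_f_R0
        (fun k => match k with 0%nat => s | 1%nat => t | _ => 0 end) (S N) = s + t).
      { intros N; induction N as [|N IH]; [reflexivity|]; rewrite tech5, IH; lra. }
      intros [|N]; [simpl; lra|rewrite h; lra].
Qed.

Lemma covered_shift {n} (A : set n) (s : R) (g : Rn n) :
  covered A s -> covered (fun z => A (vadd z g)) s.
Proof.
  intros [a [b [hab [hc hs]]]].
  exists (fun k => vadd (a k) (vopp g)), (fun k => vadd (b k) (vopp g)); split; [|split].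
  - intros k i; specialize (hab k i); unfold vadd, vopp; lra.
  - intros z hz; destruct (hc _ hz) as [k hk]; exists k; intros i.
    specialize (hk i); unfold vadd, vopp in *; lra.
  - intros N; apply Rle_trans with (2 := hs N), Req_le, sum_eq; intros k _.
    unfold box_vol; f_equal; extensionality i; unfold vadd, vopp; ring.
Qed.

Lemma null_subset {n} (A B : set n) : subset A B -> null B -> null A.
Proof. intros h hB eps he; apply (covered_mono A B eps eps h); [lra|]; exact (hB eps he). Qed.

Lemma null_cunion {n} (A : nat -> set n) :
  (forall k, null (A k)) -> null (fun x => exists k, A k x).
Proof.
  intros h eps he; apply covered_cunion with (fun k => eps * (1 / 2) ^ S k).
  - intros k; apply h, Rmult_lt_0_compat; [exact he|apply half_pow_pos].
  - intros N; apply sum_half_pow_le; lra.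
Qed.

Lemma null_union {n} (A B : set n) : null A -> null B -> null (fun x => A x \/ B x).
Proof.
  intros hA hB; apply (null_subset _ (fun x => exists k, (match k with O => A | _ => B end) x)).
  - intros x [h|h]; [exists 0%nat|exists 1%nat]; exact h.
  - apply null_cunion; intros [|k]; assumption.
Qed.

Lemma null_shift {n} (A : set n) (g : Rn n) : null A -> null (fun z => A (vadd z g)).
Proof. intros h eps he; apply covered_shift, (h eps he). Qed.

(** * Measurability *)

(* Caratheodory's criterion; sets [E] of infinite outer measure are vacuously fine. *)
Definition measurable {n} (B : set n) : Prop :=
  forall E s eps, 0 < eps -> covered E s ->
    exists s1 s2, s1 + s2 <= s + eps /\
      covered (fun x => E x /\ B x) s1 /\ covered (fun x => E x /\ ~ B x) s2.

Lemma measurable_ext {n} (A B : set n) :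
  (forall x, A x <-> B x) -> measurable A -> measurable B.
Proof. intros h; rewrite (set_ext A B h); trivial. Qed.

Lemma measurable_compl {n} (B : set n) : measurable B -> measurable (fun x => ~ B x).
Proof.
  intros hB E s eps he hE; destruct (hB E s eps he hE) as [s1 [s2 [h [h1 h2]]]].
  exists s2, s1; split; [lra|]; split; [exact h2|].
  revert h1; apply covered_mono; [|lra].
  intros x [hx hn]; split; [exact hx|apply NNPP, hn].
Qed.

(** The sets [B k] are split off one after another: [Ek k] is what the first [k] of them leave of
    [E], [r k] bounds it, and [t k] bounds the part that [B k] takes. The errors [d k] sum to at
    most [eps / 2]. *)
Lemma measurable_cunion {n} (B : nat -> set n) :
  (forall k, measurable (B k)) -> measurable (fun x => exists k, B k x).
Proof.
  intros hB E s eps he hE.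
  set (Ek := fun k x => E x /\ forall j, (j < k)%nat -> ~ B j x).
  set (d := fun k => eps / 2 * (1 / 2) ^ S k).
  assert (hd : forall k, 0 < d k).
  { intros k; apply Rmult_lt_0_compat; [lra|apply half_pow_pos]. }
  destruct (dependent_choice_on (fun k r => covered (Ek k) r)
    (fun k r r' => exists t, covered (fun x => Ek k x /\ B k x) t /\ t + r' <= r + d k) s)
    as [r [hr0 hr]].
  - revert hE; apply covered_mono; [intros x hx; apply hx|lra].
  - intros k r hr; destruct (hB k _ r (d k) (hd k) hr) as [t [r' [h [h1 h2]]]].
    exists r'; split; [|exists t; split; [exact h1|exact h]].
    revert h2; apply covered_mono; [|lra].
    intros x [hx hj]; split; [split; [exact hx|]|]; [intros j hjk|]; apply hj; lia.
  - assert (ht : forall k, exists t, covered (fun x => Ek k x /\ B k x) t /\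
      t + r (S k) <= r k + d k) by (intros k; apply hr).
    apply functional_choice in ht; destruct ht as [t ht].
    assert (hsum : forall N, sum_f_R0 t N + r (S N) <= s + eps / 2).
    { assert (h : forall N, sum_f_R0 t N + r (S N) <= s + sum_f_R0 d N).
      { intros N; induction N as [|N IH].
        - simpl; rewrite <- hr0; apply ht.
        - rewrite !tech5; destruct (ht (S N)) as [_ h]; lra. }
      intros N; specialize (h N); pose proof (sum_half_pow_le (eps / 2) N) as hp.
      fold d in hp; lra. }
    assert (hrpos : forall k, 0 <= r k) by (intros k; apply (covered_ge0 (Ek k)), hr).
    destruct (sums_sup t (s + eps / 2)) as [T [hT1 hT2]].
    { intros N; specialize (hsum N); specialize (hrpos (S N)); lra. }
    (* The other [eps / 2] pays for stopping at a finite stage: [T] bounds everything ever taken,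
       and [r (S N)] bounds what is never taken. *)
    assert (hN : exists N, T - eps / 2 < sum_f_R0 t N).
    { apply NNPP; intros hn; assert (T <= T - eps / 2); [|lra].
      apply hT2; intros N; apply Rnot_lt_le; intros h; apply hn; exists N; exact h. }
    destruct hN as [N hN]; exists T, (r (S N)); split; [specialize (hsum N); lra|]; split.
    + apply (covered_mono _ (fun x => exists k, Ek k x /\ B k x) T); [|lra|].
      * intros x [hx [k hk]].
        (* the least index [k] with [x] in [B k] *)
        revert hk; induction k as [k IH] using (well_founded_induction Wf_nat.lt_wf); intros hk.
        destruct (classic (exists j, (j < k)%nat /\ B j x)) as [[j [hj hBj]]|hn].
        { apply (IH j hj hBj). }
        exists k; split; [split; [exact hx|]|exact hk].
        intros j hj hBj; apply hn; exists j; split; assumption.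
      * apply covered_cunion with t; [intros k; apply ht|exact hT1].
    + destruct (hr (S N)) as [h _]; revert h; apply covered_mono; [|lra].
      intros x [hx hn]; split; [exact hx|]; intros j _ hj; apply hn; exists j; exact hj.
Qed.

Definition vset {n} (f : Rn n) (i : Fin.t n) (v : R) : Rn n :=
  fun j => if Fin.eq_dec j i then v else f j.

Lemma vset_same {n} (f : Rn n) (i : Fin.t n) (v : R) : vset f i v i = v.
Proof. unfold vset; destruct (Fin.eq_dec i i); [reflexivity|contradiction]. Qed.

Lemma vset_other {n} (f : Rn n) (i j : Fin.t n) (v : R) : j <> i -> vset f i v j = f j.
Proof. intros h; unfold vset; destruct (Fin.eq_dec j i); [contradiction|reflexivity]. Qed.

Lemma measurable_halfspace {n} (i : Fin.t n) (c : R) : measurable (fun x : Rn n => x i <= c).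
Proof.
  intros E s eps he [a [b [hab [hc hs]]]].
  (* The cut position is clamped into the box, so a box on one side of the hyperplane has a
     degenerate other part. *)
  set (m := fun k => Rmax (a k i) (Rmin (b k i) c)).
  assert (hm : forall k, a k i <= m k <= b k i).
  { intros k; specialize (hab k i); split; [apply Rmax_l|apply Rmax_lub; [lra|apply Rmin_l]]. }
  assert (hl : forall k j, a k j <= vset (b k) i (m k) j).
  { intros k j; destruct (Fin.eq_dec j i) as [->|hne].
    - rewrite vset_same; apply hm.
    - rewrite vset_other by exact hne; apply hab. }
  assert (hr : forall k j, vset (a k) i (m k) j <= b k j).
  { intros k j; destruct (Fin.eq_dec j i) as [->|hne].
    - rewrite vset_same; apply hm.
    - rewrite vset_other by exact hne; apply hab. }
  destruct (sums_split (fun k => box_vol (a k) (vset (b k) i (m k)))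
    (fun k => box_vol (vset (a k) i (m k)) (b k)) s) as [s1 [s2 [h [h1 h2]]]].
  - intros k; apply box_vol_ge0, hl.
  - intros k; apply box_vol_ge0, hr.
  - intros N; rewrite <- sum_plus; apply Rle_trans with (2 := hs N), Req_le, sum_eq.
    intros k _; symmetry; apply (vprod_split n) with i.
    + rewrite !vset_same; ring.
    + intros j hne; rewrite !vset_other by exact hne; split; reflexivity.
  - exists s1, s2; split; [lra|]; split.
    + exists a, (fun k => vset (b k) i (m k)); split; [exact hl|]; split; [|exact h1].
      intros x [hx hxi]; destruct (hc x hx) as [k hk]; exists k; intros j.
      destruct (Fin.eq_dec j i) as [->|hne].
      * rewrite vset_same; specialize (hk i); split; [lra|].
        apply Rle_trans with (2 := Rmax_r _ _), Rmin_glb; lra.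
      * rewrite vset_other by exact hne; apply hk.
    + exists (fun k => vset (a k) i (m k)), b; split; [exact hr|]; split; [|exact h2].
      intros x [hx hxi]; destruct (hc x hx) as [k hk]; exists k; intros j.
      destruct (Fin.eq_dec j i) as [->|hne].
      * rewrite vset_same; specialize (hk i); split; [|lra].
        apply Rmax_lub; [lra|]; apply Rle_trans with (1 := Rmin_r _ _); lra.
      * rewrite vset_other by exact hne; apply hk.
Qed.

Lemma measurable_union {n} (A B : set n) :
  measurable A -> measurable B -> measurable (fun x => A x \/ B x).
Proof.
  intros hA hB.
  apply (measurable_ext (fun x => exists k, (match k with O => A | _ => B end) x)).
  - intros x; split; [intros [[|k] h]; tauto|].
    intros [h|h]; [exists 0%nat|exists 1%nat]; exact h.
  - apply measurable_cunion; intros [|k]; assumption.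
Qed.

(** Lets a countable union be restricted by a side condition on its indices, as in
    [measurable_open]. *)
Lemma measurable_const {n} (P : Prop) : (1 <= n)%nat -> measurable (fun _ : Rn n => P).
Proof.
  intros hn E s eps he hE; destruct (classic P) as [h|h]; [exists s, 0|exists 0, s].
  all: split; [lra|]; split.
  all: try (apply covered_empty; [exact hn|]; tauto).
  all: revert hE; apply covered_mono; [intros x hx; apply hx|lra].
Qed.

Lemma measurable_fin_union {n} (m : nat) (F : Fin.t m -> set n) :
  (1 <= n)%nat -> (forall i, measurable (F i)) -> measurable (fun x => exists i, F i x).
Proof.
  intros hn; induction m as [|m IH]; intros hF.
  - apply (measurable_ext (fun _ => False)); [|apply measurable_const, hn].
    intros x; split; [tauto|]; intros [i _]; inversion i.
  - apply (measurable_ext (fun x => F Fin.F1 x \/ exists i, F (Fin.FS i) x)).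
    + intros x; split.
      * intros [h|[i h]]; [exists Fin.F1|exists (Fin.FS i)]; exact h.
      * intros [i h]; revert h; apply (Fin.caseS' i); [left|intros j h; right; exists j]; assumption.
    + apply measurable_union; [apply hF|]; apply IH; intros i; apply hF.
Qed.

Lemma measurable_inter {n} (A B : set n) :
  measurable A -> measurable B -> measurable (fun x => A x /\ B x).
Proof.
  intros hA hB; apply (measurable_ext (fun x => ~ (~ A x \/ ~ B x))).
  - intros x; destruct (classic (A x)), (classic (B x)); tauto.
  - apply measurable_compl, measurable_union; apply measurable_compl; assumption.
Qed.

Lemma measurable_closed_ball {n} (x : Rn n) (r : R) :
  (1 <= n)%nat -> measurable (box (fun i => x i - r) (fun i => x i + r)).
Proof.
  intros hn.
  apply (measurable_ext (fun y => ~ exists i, ~ (x i - r <= y i <= x i + r))).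
  - intros y; split.
    + intros h i; apply NNPP; intros h'; apply h; exists i; exact h'.
    + intros h [i h']; apply h', h.
  - apply measurable_compl, measurable_fin_union; [exact hn|]; intros i.
    apply measurable_compl, measurable_inter; [|apply measurable_halfspace].
    (* Half-spaces are available only as [x i <= c], so the lower bound is the complement of a
       countable union of them. *)
    apply (measurable_ext (fun y => ~ exists k, y i <= x i - r - / INR (S k))).
    + intros y; split.
      * intros h; apply Rnot_lt_le; intros h'; apply h.
        destruct (archimed_cor1 (x i - r - y i)) as [[|k] [hk hk0]]; [lra|lia|].
        exists k; lra.
      * intros h [k hk]; pose proof (Rinv_0_lt_compat _ (lt_0_INR (S k) (Nat.lt_0_succ k))); lra.
    + apply measurable_compl, measurable_cunion; intros k; apply measurable_halfspace.
Qed.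

Lemma measurable_open {n} (U : set n) : (1 <= n)%nat -> is_open U -> measurable U.
Proof.
  intros hn hU; destruct (dense_sequence n) as [p hp].
  set (Q := fun k j => @box n (fun i => p k i - / INR (S j)) (fun i => p k i + / INR (S j))).
  apply (measurable_ext (fun x => exists k j, Q k j x /\ subset (Q k j) U)).
  - intros x; split; [intros [k [j [h hs]]]; apply hs, h|]; intros hx.
    destruct (hU x hx) as [r [hr h]].
    (* A box of radius below [r / 2] that contains [x] stays within [r] of [x]. *)
    destruct (archimed_cor1 (r / 2)) as [[|j] [hj hj0]]; [lra|lia|].
    assert (hpos : 0 < / INR (S j)) by (apply Rinv_0_lt_compat, lt_0_INR; lia).
    destruct (hp x (/ INR (S j)) hpos) as [k hk]; exists k, j; split.
    + intros i; specialize (hk i); apply Rabs_def2 in hk; lra.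
    + intros y hy; apply h; intros i; specialize (hk i); specialize (hy i).
      apply Rabs_def2 in hk; apply Rabs_def1; lra.
  - apply measurable_cunion; intros k; apply measurable_cunion; intros j.
    apply measurable_inter; [apply measurable_closed_ball, hn|apply measurable_const, hn].
Qed.

Lemma borel_measurable {n} (B : set n) : (1 <= n)%nat -> borel B -> measurable B.
Proof.
  intros hn hB; induction hB as [U hU|A hA IH|F hF IH].
  - apply measurable_open; assumption.
  - apply measurable_compl, IH.
  - apply measurable_cunion, IH.
Qed.

(** * Density of non-null sets *)

Lemma null_local {n} (A : set n) (r : R) :
  0 < r -> (forall p : Rn n, null (fun x => A x /\ box p (fun i => p i + r) x)) -> null A.
Proof.
  intros hr h; destruct (dense_sequence n) as [p hp].
  apply (null_subset _ (fun x => exists k,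
    A x /\ box (fun i => p k i - r / 2) (fun i => p k i - r / 2 + r) x)).
  - intros x hx; destruct (hp x (r / 2)) as [k hk]; [lra|]; exists k; split; [exact hx|].
    intros i; specialize (hk i); apply Rabs_def2 in hk; lra.
  - apply null_cunion; intros k; apply h.
Qed.

(* Refining a cover box by box multiplies its total volume by [lam], and this can be iterated. *)
Lemma sparse_null {n} (A : set n) (p q : Rn n) (lam : R) :
  (1 <= n)%nat -> 0 <= lam < 1 -> (forall i, p i <= q i) -> subset A (box p q) ->
  (forall a b : Rn n, (forall i, p i <= a i /\ a i <= b i /\ b i <= q i) ->
     covered (fun x => A x /\ box a b x) (lam * box_vol a b)) ->
  null A.
Proof.
  intros hn hlam hpq hA hsp.
  assert (hstep : forall s, covered A s -> covered A (lam * s)).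
  { intros s [a [b [hab [hc hs]]]].
    (* Sparseness is assumed only inside [box p q]. Clamping the corners brings each covering box
       inside, keeps its points of [A] and lengthens no side. *)
    set (clamp := fun (x : Rn n) i => Rmax (p i) (Rmin (x i) (q i))).
    assert (hcl : forall x y i, x i <= y i -> p i <= clamp x i /\ clamp x i <= clamp y i /\
      clamp y i <= q i /\ clamp y i - clamp x i <= y i - x i).
    { intros x y i h; specialize (hpq i); unfold clamp, Rmax, Rmin.
      repeat destruct (Rle_dec _ _); lra. }
    apply (covered_mono _ (fun x => exists k, A x /\ box (clamp (a k)) (clamp (b k)) x)
      (lam * s)); [|lra|].
    - intros x hx; destruct (hc x hx) as [k hk]; exists k; split; [exact hx|]; intros i.
      specialize (hk i); specialize (hA x hx i); unfold clamp, Rmax, Rmin.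
      repeat destruct (Rle_dec _ _); lra.
    - apply covered_cunion with (fun k => lam * box_vol (clamp (a k)) (clamp (b k))).
      + intros k; apply hsp; intros i; specialize (hcl (a k) (b k) i (hab k i)); tauto.
      + intros N; rewrite sum_scale; apply Rmult_le_compat_l; [lra|].
        apply Rle_trans with (2 := hs N), sum_Rle; intros k _; apply vprod_le; intros i.
        specialize (hcl (a k) (b k) i (hab k i)); lra. }
  assert (hiter : forall k, covered A (box_vol p q * lam ^ k)).
  { intros k; induction k as [|k IH].
    - apply (covered_mono _ (box p q) (box_vol p q)); [exact hA|simpl; lra|].
      apply covered_box; assumption.
    - replace (box_vol p q * lam ^ S k) with (lam * (box_vol p q * lam ^ k)) by (simpl; ring).
      apply hstep, IH. }
  intros eps he.
  destruct (pow_scale_small lam (box_vol p q) eps hlam (box_vol_ge0 p q hpq) he) as [k hk].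
  apply (covered_mono A A (box_vol p q * lam ^ k) eps); [intros x hx; exact hx|lra|apply hiter].
Qed.

(** A weak form of Lebesgue's density theorem: otherwise the part of [A] in every unit box would be
    null by [sparse_null]. Sides of length at most 1 are what [tile_unit_box] requires. *)
Lemma nonnull_dense_box {n} (A : set n) (lam : R) :
  (1 <= n)%nat -> 0 <= lam < 1 -> ~ null A ->
  exists a b : Rn n, (forall i, a i < b i <= a i + 1) /\
    ~ covered (fun x => A x /\ box a b x) (lam * box_vol a b).
Proof.
  intros hn hlam hA; apply NNPP; intros hno; apply hA.
  apply (null_local A 1 Rlt_0_1); intros p.
  apply (sparse_null _ p (fun i => p i + 1) lam hn hlam); [intros; lra|intros x [_ h]; exact h|].
  intros a b hab.
  apply (covered_mono _ (fun x => A x /\ box a b x) (lam * box_vol a b));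
    [intros x [[h _] h']; split; assumption|lra|].
  apply NNPP; intros hc; apply hno; exists a, b; split; [|exact hc].
  (* A box of volume zero satisfies the sparseness bound trivially, so a box violating it has only
     positive sides. *)
  assert (hv : 0 < box_vol a b).
  { apply Rnot_le_lt; intros hv; apply hc.
    assert (hv0 : box_vol a b = 0).
    { apply Rle_antisym; [exact hv|]; apply box_vol_ge0; intros i; apply hab. }
    rewrite hv0, Rmult_0_r, <- hv0.
    apply (covered_mono _ (box a b) (box_vol a b)); [intros x [_ h]; exact h|lra|].
    apply covered_box; [exact hn|intros i; apply hab]. }
  intros i; specialize (vprod_pos_inv n (fun i => b i - a i)) as hpos.
  specialize (hpos ltac:(intros j; specialize (hab j); lra) hv i); specialize (hab i).
  simpl in hpos; lra.
Qed.

Lemma pow_near_1 (n : nat) (c : R) : 1 < c -> exists t, 0 < t /\ (1 + t) ^ n <= c.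
Proof.
  revert c; induction n as [|n IH]; intros c hc.
  - exists 1; simpl; lra.
  - destruct (IH ((1 + c) / 2)) as [t [ht h]]; [lra|].
    (* Chosen so that [1 + (c - 1) / (c + 1)], which is [2 * c / (c + 1)], times [(1 + c) / 2] is
       exactly [c]. *)
    assert (hq : 0 < (c - 1) / (c + 1)) by (apply Rdiv_lt_0_compat; lra).
    set (u := Rmin t ((c - 1) / (c + 1))).
    assert (hu : 0 < u) by (apply Rmin_pos; assumption).
    exists u; split; [exact hu|]; simpl.
    pose proof (Rmin_l t ((c - 1) / (c + 1))) as h1; fold u in h1.
    pose proof (Rmin_r t ((c - 1) / (c + 1))) as h2; fold u in h2.
    assert (hp : (1 + u) ^ n <= (1 + c) / 2).
    { apply Rle_trans with (2 := h), pow_incr; lra. }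
    assert (hp0 : 0 <= (1 + u) ^ n) by (apply pow_le; lra).
    assert (hm : (1 + u) * (1 + u) ^ n <= (1 + (c - 1) / (c + 1)) * ((1 + c) / 2)).
    { apply Rmult_le_compat; lra. }
    replace ((1 + (c - 1) / (c + 1)) * ((1 + c) / 2)) with c in hm by (field; lra); exact hm.
Qed.

(* Steinhaus: if [x] is small and not in the closure [L], then [L] and [L + x] are disjoint,
   yet both nearly fill a common box. *)
Lemma subgroup_nonnull_dense {n} (H : set n) :
  (1 <= n)%nat -> subgroup H -> ~ null H -> forall x, closure H x.
Proof.
  intros hn hH hnull.
  pose proof (closure_subgroup H hH) as hL; set (L := closure H) in *.
  assert (hLnull : ~ null L).
  { intros h; apply hnull; revert h; apply null_subset, subset_closure. }
  assert (hmeas : measurable L).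
  { apply (measurable_ext (fun x => ~ ~ L x)); [intros x; split; [apply NNPP|tauto]|].
    apply measurable_compl, measurable_open; [exact hn|].
    intros x hx; apply NNPP; intros hno; apply hx; intros eps he; apply NNPP; intros hno'.
    apply hno; exists (eps / 2); split; [lra|]; intros y hy hLy.
    destruct (hLy (eps / 2)) as [z [hz hzy]]; [lra|]; apply hno'; exists z; split; [exact hz|].
    intros i; specialize (hy i); specialize (hzy i).
    pose proof (Rabs_triang (z i - y i) (y i - x i)) as ht.
    replace (z i - y i + (y i - x i)) with (z i - x i) in ht by ring; lra. }
  (* The constants must clash: [L] and its complement each need more than 3/4 of the volume of
     [box a b] within a box of 5/4 of that volume, and the measurability error is 1/4. *)
  destruct (nonnull_dense_box L (3 / 4) hn ltac:(lra) hLnull) as [a [b [hab hd]]].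
  destruct (pow_near_1 n (5 / 4)) as [t [ht htn]]; [lra|].
  destruct (vector_lower_bound (fun i => b i - a i)) as [m [hm hmi]].
  { intros i; specialize (hab i); lra. }
  assert (hvol : 0 <= box_vol a b) by (apply box_vol_ge0; intros i; specialize (hab i); lra).
  assert (hvpos : 0 < box_vol a b).
  { apply Rnot_le_lt; intros h; apply hd.
    apply (covered_mono _ (box a b) (box_vol a b)); [intros x [_ h']; exact h'|lra|].
    apply covered_box; [exact hn|intros i; specialize (hab i); lra]. }
  apply (subgroup_with_ball_full L (t / 2 * m) hL); [apply Rmult_lt_0_compat; lra|].
  intros x hx; apply NNPP; intros hxL.
  (* The enlarged box contains both [box a b] and its translate by [x]; each side grows by the
     factor [1 + t]. *)
  set (a' := fun i => a i - t / 2 * (b i - a i)).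
  set (b' := fun i => b i + t / 2 * (b i - a i)).
  assert (hx' : forall i, Rabs (x i) <= t / 2 * (b i - a i)).
  { intros i; specialize (hx i); unfold vzero in hx; rewrite Rminus_0_r in hx.
    specialize (hmi i); apply (Rmult_le_compat_l (t / 2)) in hmi; lra. }
  assert (hw : forall i, 0 <= t / 2 * (b i - a i)).
  { intros i; specialize (hab i); apply Rmult_le_pos; lra. }
  assert (hvol' : box_vol a' b' <= 5 / 4 * box_vol a b).
  { replace (box_vol a' b') with ((1 + t) ^ n * box_vol a b).
    - apply Rmult_le_compat_r; assumption.
    - unfold box_vol; rewrite <- vprod_scale; f_equal; extensionality i; unfold a', b'; field. }
  destruct (hmeas (box a' b') (box_vol a' b') (box_vol a b / 4)) as [s1 [s2 [hs [h1 h2]]]].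
  { lra. }
  { apply covered_box; [exact hn|]; intros i; specialize (hw i); specialize (hab i).
    unfold a', b'; lra. }
  assert (hs1 : 3 / 4 * box_vol a b < s1).
  { apply Rnot_le_lt; intros h; apply hd; revert h1; apply covered_mono; [|exact h].
    intros y [hy hyb]; split; [|exact hy]; intros i; specialize (hyb i); specialize (hw i).
    unfold a', b'; lra. }
  assert (hs2 : 3 / 4 * box_vol a b < s2).
  { apply Rnot_le_lt; intros h; apply hd.
    apply (covered_shift _ _ x) in h2; revert h2; apply covered_mono; [|exact h].
    intros y [hy hyb]; split.
    - intros i; specialize (hyb i); specialize (hx' i).
      pose proof (Rle_abs (x i)); pose proof (Rle_abs (- x i)); rewrite Rabs_Ropp in *.
      unfold a', b', vadd; lra.
    - intros hyx; apply hxL.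
      replace x with (vadd (vadd y x) (vopp y)).
      + apply hL; [exact hyx|apply hL, hy].
      + extensionality i; unfold vadd, vopp; ring. }
  lra.
Qed.

(** * Ergodicity of dense subgroups *)

Lemma covered_list {n} {X : Type} (F : X -> set n) (l : list X) (s : R) :
  (1 <= n)%nat -> (forall c, In c l -> covered (F c) s) ->
  covered (fun x => exists c, In c l /\ F c x) (INR (length l) * s).
Proof.
  intros hn; induction l as [|c l IH]; intros h.
  - simpl; rewrite Rmult_0_l; apply covered_empty; [exact hn|]; intros x [c [[] _]].
  - apply (covered_mono _ (fun x => F c x \/ exists d, In d l /\ F d x)
      (s + INR (length l) * s)).
    + intros x [d [[->|hd] hx]]; [left; exact hx|right; exists d; split; assumption].
    + cbn [length]; rewrite S_INR; lra.
    + apply covered_union; [exact hn|apply h; left; reflexivity|].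
      apply IH; intros d hd; apply h; right; exact hd.
Qed.

(** A grid with [m] steps per axis, where [m] is [/ q0] rounded up. Then [m * q0] is at most
    [1 + q0], hence at most 2, which gives one factor 2 per dimension. *)
Lemma tile_unit_box (n : nat) (q p : Rn n) :
  (forall i, 0 < q i <= 1) ->
  exists l : list (Rn n), INR (length l) * vprod n q <= 2 ^ n /\
    forall x, box p (fun i => p i + 1) x ->
      exists c, In c l /\ box c (fun i => c i + q i) x.
Proof.
  induction n as [|n IH]; intros hq.
  - exists (vzero :: nil); split; [simpl; lra|]; intros x _; exists vzero.
    split; [left; reflexivity|]; intros i; inversion i.
  - destruct (IH (fun i => q (Fin.FS i)) (fun i => p (Fin.FS i))) as [l [hl hc]].
    { intros i; apply hq. }
    destruct (hq Fin.F1) as [hq0 hq1]; set (q0 := q Fin.F1) in *; set (p0 := p Fin.F1) in *.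
    assert (hm : exists m, 1 <= INR m * q0 <= 2).
    { destruct (archimed (/ q0)) as [h1 h2].
      pose proof (Rinv_0_lt_compat _ hq0) as hi.
      exists (Z.to_nat (up (/ q0))); rewrite INR_IZR_INZ, Z2Nat.id by (apply le_IZR; lra).
      pose proof (Rinv_l q0 ltac:(lra)) as e.
      split.
      - rewrite <- e; apply Rmult_le_compat_r; lra.
      - apply Rle_trans with ((/ q0 + 1) * q0); [apply Rmult_le_compat_r; lra|lra]. }
    destruct hm as [m [hm1 hm2]].
    exists (map (fun kc i => Fin.caseS' i (fun _ => R) (p0 + INR (fst kc) * q0) (snd kc))
      (list_prod (seq 0 m) l)); split.
    + rewrite length_map, length_prod, length_seq, mult_INR; simpl; fold q0.
      replace (INR m * INR (length l) * (q0 * vprod n (fun i => q (Fin.FS i))))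
        with (INR m * q0 * (INR (length l) * vprod n (fun i => q (Fin.FS i)))) by ring.
      apply Rmult_le_compat; [lra| |lra|exact hl].
      apply Rmult_le_pos; [apply pos_INR|]; apply vprod_ge0; intros i.
      specialize (hq (Fin.FS i)); lra.
    + intros x hx; destruct (hc (fun i => x (Fin.FS i))) as [c [hcl hcx]].
      { intros i; apply hx. }
      assert (hk : exists k, (k < m)%nat /\
        p0 + INR k * q0 <= x Fin.F1 <= p0 + INR k * q0 + q0).
      { pose proof (hx Fin.F1) as hx1; simpl in hx1; fold p0 in hx1.
        assert (hx2 : p0 <= x Fin.F1 <= p0 + INR m * q0) by lra.
        assert (hmpos : (0 < m)%nat).
        { destruct m; [simpl in hm1; lra|lia]. }
        clear hm1 hm2 hx1; revert hmpos hx2; induction m as [|m IHm]; [lia|]; intros _ hx2.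
        destruct (Rle_dec (p0 + INR m * q0) (x Fin.F1)) as [h|h].
        - exists m; split; [lia|]; rewrite S_INR in hx2; lra.
        - destruct m as [|m]; [simpl in h; lra|].
          destruct IHm as [k [hk h']]; [lia|lra|]; exists k; split; [lia|exact h']. }
      destruct hk as [k [hkm hkx]].
      exists (fun i => Fin.caseS' i (fun _ => R) (p0 + INR k * q0) c); split.
      * apply in_map_iff; exists (k, c); split; [reflexivity|].
        apply in_prod; [apply in_seq; lia|exact hcl].
      * intros i; apply (Fin.caseS' i); simpl; [exact hkx|exact hcx].
Qed.

(* If the complement of [B] is non-null, it nearly fills some box [Q], so [B] is sparse in [Q]
   and in all its translates by [H]; these tile any unit box with bounded overlap. *)
Lemma null_dichotomy {n} (H B : set n) :
  (1 <= n)%nat -> subgroup H -> (forall x, closure H x) -> invariant_under H B -> borel B ->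
  null B \/ null (fun x => ~ B x).
Proof.
  intros hn hH hdense hinv hB; destruct (classic (null (fun x => ~ B x))) as [h|hC].
  { right; exact h. }
  left; apply (null_local B 1 Rlt_0_1); intros p eps he.
  assert (h4 : 0 < 4 ^ n) by (apply pow_lt; lra).
  (* In [4 ^ n], one factor [2 ^ n] comes from the overhang of the tiling and one from tiles with
     half the sides of the sparse box. *)
  set (d := Rmin (1 / 2) (eps / (2 * 4 ^ n))).
  assert (hd0 : 0 < d) by (apply Rmin_pos; [lra|]; apply Rdiv_lt_0_compat; lra).
  assert (hd1 : d <= 1 / 2) by apply Rmin_l.
  assert (hd2 : 2 * d * 4 ^ n <= eps).
  { pose proof (Rmin_r (1 / 2) (eps / (2 * 4 ^ n))) as h; fold d in h.
    apply (Rmult_le_compat_r (2 * 4 ^ n)) in h; [|lra].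
    unfold Rdiv in h; rewrite Rmult_assoc, Rinv_l in h; lra. }
  destruct (nonnull_dense_box (fun x => ~ B x) (1 - d) hn ltac:(lra) hC) as [a [b [hab hQ]]].
  assert (hab' : forall i, a i <= b i) by (intros i; specialize (hab i); lra).
  assert (hv : 0 < box_vol a b).
  { destruct (box_vol_ge0 a b hab') as [h|h]; [exact h|]; exfalso; apply hQ; rewrite <- h.
    apply (covered_mono _ (box a b) (box_vol a b)); [intros x [_ hx]; exact hx|lra|].
    apply covered_box; assumption. }
  (* Caratheodory's criterion: the complement needs more than [1 - d] of the volume, out of at most
     [1 + d], leaving less than [2 * d] for [B]. *)
  assert (hBQ : covered (fun x => box a b x /\ B x) (2 * d * box_vol a b)).
  { destruct (borel_measurable B hn hB (box a b) (box_vol a b) (d * box_vol a b))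
      as [s1 [s2 [hs [h1 h2]]]].
    - apply Rmult_lt_0_compat; assumption.
    - apply covered_box; assumption.
    - revert h1; apply covered_mono; [intros x hx; exact hx|].
      assert ((1 - d) * box_vol a b < s2); [|lra].
      apply Rnot_le_lt; intros h; apply hQ; revert h2; apply covered_mono; [|exact h].
      intros x [h1 h2]; split; assumption. }
  destruct (tile_unit_box n (fun i => 1 / 2 * (b i - a i)) p) as [l [hl hc]].
  { intros i; specialize (hab i); lra. }
  destruct (vector_lower_bound (fun i => b i - a i)) as [m [hm hmi]].
  { intros i; specialize (hab i); lra. }
  apply (covered_mono _ (fun x => exists c, In c l /\
    (B x /\ box c (fun i => c i + 1 / 2 * (b i - a i)) x))
    (INR (length l) * (2 * d * box_vol a b))).
  - intros x [hx hxp]; destruct (hc x hxp) as [c [hcl hcx]]; exists c; tauto.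
  - rewrite vprod_scale in hl; fold (box_vol a b) in hl.
    apply Rle_trans with (2 := hd2).
    replace (4 ^ n) with (2 ^ n * 2 ^ n) by (rewrite <- Rpow_mult_distr; f_equal; lra).
    assert (h2 : 0 < 2 ^ n) by (apply pow_lt; lra).
    replace ((1 / 2) ^ n) with (/ 2 ^ n) in hl
      by (rewrite <- pow_inv; f_equal; lra).
    apply (Rmult_le_compat_l (2 ^ n)) in hl; [|lra].
    replace (2 ^ n * (INR (length l) * (/ 2 ^ n * box_vol a b)))
      with (INR (length l) * box_vol a b) in hl by (field; lra).
    apply (Rmult_le_compat_l (2 * d)) in hl; lra.
  - apply covered_list; [exact hn|]; intros c _.
    (* The exact translation would centre the half-size tile at [c] in the moved box, with a margin
       of a quarter side all around; [m / 4] keeps the error within that margin. *)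
    destruct (hdense (fun i => c i - a i - (b i - a i) / 4) (m / 4)) as [h [hh hball]]; [lra|].
    apply (covered_shift _ _ (vopp h)) in hBQ; revert hBQ; apply covered_mono; [|lra].
    intros x [hBx hx]; split.
    + intros i; specialize (hx i); specialize (hball i); specialize (hmi i); simpl in hmi.
      apply Rabs_def2 in hball; unfold vadd, vopp; lra.
    + apply hinv; [apply hH, hh|exact hBx].
Qed.

(** * Hulls of subgroups and the contradiction *)

Lemma hull_invariant {n} (F : set n -> Prop) (psi : set n -> set n) (G : set n) :
  subgroup G -> F G -> translation_invariant F psi -> invariant_under G (psi G).
Proof.
  intros hG hF hpsi g z hg hz.
  rewrite <- (translate_subgroup G g hG hg), (hpsi G g hF).
  exists z; split; [exact hz|reflexivity].
Qed.

Lemma invariant_contains_coset {n} (G A : set n) (x : Rn n) :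
  invariant_under G A -> A x -> subset G (fun z => A (vadd z x)).
Proof.
  intros hA hx g hg; replace (vadd g x) with (vadd x g); [apply hA; assumption|].
  extensionality i; unfold vadd; ring.
Qed.

Theorem theorem2p2 (n : nat) (hn : (1 <= n)%nat) :
  ((exists G : set n, subgroup G /\ null G /\ ~ meager G) ->
     ~ exists psi, borel_hull_op (@null n) (@null n) psi /\ translation_invariant (@null n) psi) /\
  ((exists H : set n, subgroup H /\ meager H /\ ~ null H) ->
     ~ exists psi, borel_hull_op (@meager n) (@meager n) psi /\ translation_invariant (@meager n) psi).
Proof.
  split.
  - intros [G [hG [hnull hmeager]]] [psi [hull htrans]].
    destruct (hull G hnull) as [hsub [hborel hdiff]].
    pose proof (hull_invariant _ psi G hG hnull htrans) as hinv.
    pose proof (invariant_compl G _ hG hinv) as hinv'.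
    assert (hBnull : null (psi G)).
    { apply (null_subset _ (fun x => G x \/ setD (psi G) G x)).
      - intros x hx; unfold setD; destruct (classic (G x)); tauto.
      - apply null_union; assumption. }
    destruct (null_ex_compl _ hBnull) as [x hx].
    destruct (meager_dichotomy G (psi G)) as [h|h]; try assumption.
    + apply subgroup_nonmeager_dense; assumption.
    + apply hmeager, (meager_subset _ _ hsub h).
    + apply hmeager, (meager_subset _ _ (invariant_contains_coset G _ x hinv' hx)).
      apply (meager_shift _ x h).
  - intros [H [hH [hmeager hnull]]] [psi [hull htrans]].
    destruct (hull H hmeager) as [hsub [hborel hdiff]].
    pose proof (hull_invariant _ psi H hH hmeager htrans) as hinv.
    pose proof (invariant_compl H _ hH hinv) as hinv'.
    assert (hBmeager : meager (psi H)).
    { apply (meager_subset _ (fun x => H x \/ setD (psi H) H x)).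
      - intros x hx; unfold setD; destruct (classic (H x)); tauto.
      - apply meager_union; assumption. }
    (* Baire's theorem plays the part that the volume argument has in the other half. *)
    assert (hex : exists x, ~ psi H x).
    { apply not_all_ex_not; intros h; apply (ball_not_meager (@vzero n) 1 Rlt_0_1).
      apply (meager_subset _ (psi H)); [intros x _; apply h|exact hBmeager]. }
    destruct hex as [x hx].
    destruct (null_dichotomy H (psi H)) as [h|h]; try assumption.
    + apply subgroup_nonnull_dense; assumption.
    + apply hnull, (null_subset _ _ hsub h).
    + apply hnull, (null_subset _ _ (invariant_contains_coset H _ x hinv' hx)).
      apply (null_shift _ x h).
Qed.
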